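(* Let $(M,g)$ be a semi-Riemannian manifold of dimension $n\ge 3$. Consider the condition $$(\ast)\quad (P\cdot P)(X_1,X_2,X_3,X_4,X_5,X_6)+(P\cdot P)(X_3,X_4,X_5,X_6,X_1,X_2)+(P\cdot P)(X_5,X_6,X_1,X_2,X_3,X_4)=0$$ for all vector fields $X_1,\dots,X_6$ on $M$. Then $(\ast)$ holds if $\wedge_{R\cdot S}=\frac{1}{n-1}\,\wedge_S\cdot\wedge_S$. Conversely to this, if $(\ast)$ holds, then (i) $n(n-1)\,R\cdot S=\kappa\, Q(g,S)$; (ii) $S\wedge S=g\wedge S^2$; (iii) $n^2S^2-2n\kappa S+\kappa^2 g=0$; moreover, if the manifold is Riemannian, then it is an Einstein manifold.
   Context: $(M,g)$ is a connected smooth semi-Riemannian manifold of dimension $n\ge 3$; $R$ is the $(0,4)$ Riemann curvature tensor, with the sign convention that the Ricci tensor $S(X_2,X_3)$ is the $g$-trace of $R(X_1,X_2,X_3,X_4)$ over $X_1,X_4$; $\kappa$ is the scalar curvature; $\mathcal S$ is the Ricci operator, $g(\mathcal SX,Y)=S(X,Y)$, and $S^2(X,Y)=g(\mathcal S^2X,Y)$. Einstein means $S=\frac{\kappa}{n}g$. The projective curvature tensor is $P(X_1,X_2,X_3,X_4)=R(X_1,X_2,X_3,X_4)-\frac{1}{n-1}\left[S(X_2,X_3)g(X_1,X_4)-S(X_1,X_3)g(X_2,X_4)\right]$. For a $(0,4)$-tensor $D$, let $\mathcal D$ be the $(1,3)$-tensor with $g(\mathcal D(X,Y)X_1,X_2)=D(X,Y,X_1,X_2)$.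 For a $(0,k)$-tensor $H$, the $(0,k+2)$-tensor $D\cdot H$ is $$(D\cdot H)(X_1,\dots,X_k,X,Y)=-H(\mathcal D(X,Y)X_1,X_2,\dots,X_k)-\cdots-H(X_1,\dots,X_{k-1},\mathcal D(X,Y)X_k).$$ For a symmetric $(0,2)$-tensor $A$, $(X\wedge_AY)Z=A(Y,Z)X-A(X,Z)Y$, and $Q(A,H)(X_1,\dots,X_k,X,Y)=-\sum_{i=1}^k H(X_1,\dots,(X\wedge_AY)X_i,\dots,X_k)$. $\wedge_S$ denotes the $(0,4)$-tensor $\wedge_S(X_1,X_2,X_3,X_4)=g((X_1\wedge_SX_2)X_3,X_4)=S(X_2,X_3)g(X_1,X_4)-S(X_1,X_3)g(X_2,X_4)$; thus $\wedge_S\cdot\wedge_S=Q(S,\wedge_S)$ is a $(0,6)$-tensor. $\wedge_{R\cdot S}$ denotes the $(0,6)$-tensor $$\wedge_{R\cdot S}(X_1,X_2,X_3,X_4,X,Y)=(R\cdot S)(X_2,X_3,X,Y)\,g(X_1,X_4)-(R\cdot S)(X_1,X_3,X,Y)\,g(X_2,X_4).$$ The Kulkarni–Nomizu product of $(0,2)$-tensors is $(A\wedge E)(X_1,X_2,X_3,X_4)=A(X_1,X_4)E(X_2,X_3)+A(X_2,X_3)E(X_1,X_4)-A(X_1,X_3)E(X_2,X_4)-A(X_2,X_4)E(X_1,X_3)$. *)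

(* Defs.v *)
From HB Require Import structures.
From mathcomp Require Import all_boot all_order all_algebra.
From mathcomp Require Import all_classical all_reals all_analysis.

Set Implicit Arguments.
Unset Strict Implicit.
Unset Printing Implicit Defensive.

Import Order.TTheory GRing.Theory Num.Theory.
Import numFieldNormedType.Exports.

Local Open Scope classical_set_scope.
Local Open Scope ring_scope.

Definition partial (K : realType) (n : nat) (W : normedModType K)
    (a : 'I_n) (f : 'rV[K]_n -> W) : 'rV[K]_n -> W :=
  fun x => 'D_(delta_mx 0 a) f x.

(* C^oo on an open set: every iterated partial derivative is differentiable,
   hence continuous, at every point of U. *)
Definition smooth_on (K : realType) (n : nat) (W : normedModType K)
    (U : set 'rV[K]_n) (f : 'rV[K]_n -> W) : Prop :=
  forall (s : seq 'I_n) (x : 'rV[K]_n), U x ->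
    differentiable (foldr (@partial K n W) f s) x.

Record smooth_manifold (K : realType) (n : nat) := SmoothManifold {
  carrier :> topologicalType;
  carrier_hausdorff : hausdorff_space carrier;
  carrier_second_countable : @second_countable carrier;
  carrier_connected : connected [set: carrier];
  chart : Type;
  dom : chart -> set carrier;
  coord : chart -> carrier -> 'rV[K]_n;
  coord_inv : chart -> 'rV[K]_n -> carrier;
  dom_open : forall c, open (dom c);
  dom_cover : forall p : carrier, exists c, dom c p;
  coord_open : forall c, open (coord c @` dom c);
  coordK : forall c p, dom c p -> coord_inv c (coord c p) = p;
  coord_continuous : forall c, {within dom c, continuous (coord c)};
  coord_inv_continuous :
    forall c, {within coord c @` dom c, continuous (coord_inv c)};
  transition_smooth : forall c d,
    smooth_on (coord c @` (dom c `&` dom d)) (coord d \o coord_inv c)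
}.

(* A tangent vector at p is given, in a chart c around p, by the row vector of
   its components; passing to a chart d multiplies this row on the right by the
   Jacobian matrix of the transition map.  [gram c x] is the Gram matrix of the
   metric in the chart c at the point of coordinates x.  The index of the
   metric is constant because the manifold is connected. *)
Record semi_riemannian (K : realType) (n : nat) := SemiRiemannian {
  manifold :> smooth_manifold K n;
  gram : chart manifold -> 'rV[K]_n -> 'M[K]_n;
  gram_smooth : forall c a b,
    smooth_on (coord c @` dom c) (fun x => gram c x a b : K^o);
  gram_sym : forall c p, dom c p ->
    (gram c (coord c p))^T = gram c (coord c p);
  gram_nondegenerate : forall c p, dom c p ->
    gram c (coord c p) \in unitmx;
  gram_transition : forall c d p, dom c p -> dom d p ->
    let J := 'J (coord d \o coord_inv c) (coord c p) in
    gram c (coord c p) = J *m gram d (coord d p) *m J^T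
}.

Section TensorsAtAPoint.
Variables (K : realType) (n : nat).
Local Notation T := 'rV[K]_n.
Local Notation basis a := (delta_mx (0 : 'I_1) a : T).

Definition form2 := T -> T -> K.
Definition form4 := T -> T -> T -> T -> K.

(* G is the Gram matrix of the metric, Rm the (0,4) curvature tensor. *)
Variables (G : 'M[K]_n) (Rm : form4).

Definition ip : form2 := fun X Y => (X *m G *m Y^T) 0 0.

(* The vector dual to a linear form; see [ip_sharp]. *)
Definition sharp (a : T -> K) : T := (\row_b a (basis b)) *m invmx G.

Lemma ip_sharp (a : {linear T -> K^o}) (Y : T) :
  G \in unitmx -> ip (sharp a) Y = a Y.
Proof.
move=> uG; rewrite /ip /sharp mulmxKV // mxE [in RHS](row_sum_delta Y).
rewrite linear_sum; apply: eq_bigr => b _.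
by rewrite linearZ !mxE mulrC.
Qed.

Definition trace_form (A : form2) : K :=
  \sum_a \sum_b invmx G a b * A (basis a) (basis b).

Definition ricci : form2 :=
  fun X2 X3 => trace_form (fun X1 X4 => Rm X1 X2 X3 X4).

Definition scalar_curvature : K := trace_form ricci.

Definition ricci_operator (X : T) : T := sharp (ricci X).

Definition ricci_sq : form2 :=
  fun X Y => ip (ricci_operator (ricci_operator X)) Y.

Definition projective : form4 := fun X1 X2 X3 X4 =>
  Rm X1 X2 X3 X4 -
  (n%:R - 1)^-1 * (ricci X2 X3 * ip X1 X4 - ricci X1 X3 * ip X2 X4).

Definition curv_endo (D : form4) (X Y : T) : T -> T :=
  fun Z => sharp (D X Y Z).

Definition wedge_endo (A : form2) (X Y : T) : T -> T :=
  fun Z => A Y Z *: X - A X Z *: Y.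

Definition act2 (E : T -> T) (H : form2) : form2 := fun X1 X2 =>
  - H (E X1) X2 - H X1 (E X2).

Definition act4 (E : T -> T) (H : form4) : form4 := fun X1 X2 X3 X4 =>
  - H (E X1) X2 X3 X4 - H X1 (E X2) X3 X4
  - H X1 X2 (E X3) X4 - H X1 X2 X3 (E X4).

(* D . H for H a (0,2)- resp. (0,4)-tensor, and Q(A, H) for H a (0,2)-tensor. *)
Definition dot2 (D : form4) (H : form2) : form4 := fun X1 X2 X Y =>
  act2 (curv_endo D X Y) H X1 X2.

Definition dot4 (D : form4) (H : form4) : T -> T -> T -> T -> T -> T -> K :=
  fun X1 X2 X3 X4 X Y => act4 (curv_endo D X Y) H X1 X2 X3 X4.

Definition Q2 (A H : form2) : form4 := fun X1 X2 X Y =>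
  act2 (wedge_endo A X Y) H X1 X2.

Definition wedge_ricci : form4 := fun X1 X2 X3 X4 =>
  ip (wedge_endo ricci X1 X2 X3) X4.

Definition wedge_R_ricci : T -> T -> T -> T -> T -> T -> K :=
  fun X1 X2 X3 X4 X Y =>
    dot2 Rm ricci X2 X3 X Y * ip X1 X4 - dot2 Rm ricci X1 X3 X Y * ip X2 X4.

Definition kulkarni_nomizu (A E : form2) : form4 := fun X1 X2 X3 X4 =>
  A X1 X4 * E X2 X3 + A X2 X3 * E X1 X4
  - A X1 X3 * E X2 X4 - A X2 X4 * E X1 X3.

End TensorsAtAPoint.

Section LeviCivita.
Variables (K : realType) (n : nat) (G : 'rV[K]_n -> 'M[K]_n).

Definition dgram (a i j : 'I_n) (x : 'rV[K]_n) : K :=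
  partial a (fun y => G y i j : K^o) x.

(* nabla_(d_i) d_j = \sum_k christoffel k i j d_k *)
Definition christoffel (k i j : 'I_n) (x : 'rV[K]_n) : K :=
  2^-1 * \sum_l invmx (G x) k l *
    (dgram i j l x + dgram j i l x - dgram l i j x).

(* R(d_i, d_j) d_k = \sum_l curvature13 i j k l d_l, where
   R(X, Y) = nabla_X nabla_Y - nabla_Y nabla_X - nabla_[X, Y] *)
Definition curvature13 (i j k l : 'I_n) (x : 'rV[K]_n) : K :=
  partial i (fun y => christoffel l j k y : K^o) x
  - partial j (fun y => christoffel l i k y : K^o) x
  + \sum_m (christoffel m j k x * christoffel l i m x
            - christoffel m i k x * christoffel l j m x).

(* g(R(X1, X2) X3, X4) *)
Definition riemann (x : 'rV[K]_n) : form4 K n := fun X1 X2 X3 X4 =>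
  \sum_i \sum_j \sum_k \sum_l \sum_m
    X1 0 i * X2 0 j * X3 0 k * X4 0 m * (curvature13 i j k l x * G x l m).

End LeviCivita.

(* A pointwise condition on the metric and its curvature tensor, required at
   every point and in every chart around it. *)
Definition everywhere (K : realType) (n : nat) (M : semi_riemannian K n)
    (C : 'M[K]_n -> form4 K n -> Prop) : Prop :=
  forall (p : M) (c : chart M), dom c p ->
    C (gram c (coord c p)) (riemann (gram c) (coord c p)).

Definition riemannian (K : realType) (n : nat) (M : semi_riemannian K n) :=
  everywhere M (fun G _ => forall X : 'rV[K]_n, X != 0 -> 0 < ip G X X).

Definition einstein (K : realType) (n : nat) (M : semi_riemannian K n) :=
  everywhere M (fun G Rm => forall X Y : 'rV[K]_n,
    ricci G Rm X Y = scalar_curvature G Rm / n%:R * ip G X Y).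

Definition cyclic_PP (K : realType) (n : nat) (M : semi_riemannian K n) :=
  everywhere M (fun G Rm => forall X1 X2 X3 X4 X5 X6 : 'rV[K]_n,
    let PP := dot4 G (projective G Rm) (projective G Rm) in
    PP X1 X2 X3 X4 X5 X6 + PP X3 X4 X5 X6 X1 X2 + PP X5 X6 X1 X2 X3 X4 = 0).

(* Main.v *)
Require Import Defs.
From HB Require Import structures.
From mathcomp Require Import all_boot all_order all_algebra.
From mathcomp Require Import all_classical all_reals all_analysis.
From mathcomp Require Import ring lra.
Import Order.TTheory GRing.Theory Num.Theory.
Import numFieldNormedType.Exports.
Local Open Scope ring_scope.

(* Write c = 1/(n-1) and T = R.S.  The projective tensor is
   P = R - c wedge_S, so P.P = R.R - c wedge_S.R - c (wedge_T - c wedge_S.wedge_S).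
   The cyclic sums of R.R and of wedge_S.R = Q(S, R) vanish by the symmetries of R,
   so the cyclic condition only concerns H = wedge_T - c wedge_S.wedge_S, whose
   vanishing is the sufficient condition.

   Conversely, let U(x, y) be the trace of T(e, x; e, y), s = S(x, x), q = S^2(x, x),
   k the scalar curvature and N = g(x, x).  Tracing the cyclic sum of H over the slots
   1, 4, then also over 2, 3 or over 2, 5, and setting the free slots equal to x gives
     U N = c (2 q N + (n-2) s^2 - k s N),
     U = c (n q - k s),
     U = c (2 n q - 3 k s + tr(S^2) N),
   the third because tr U = 0 by the symmetries of T.  Hence s^2 = q N and
   n q - 2 k s + tr(S^2) N = 0; the trace of the latter is n tr(S^2) = k^2, and so
   (n s - k N)^2 = 0.  Therefore the metric is Einstein whatever its signature, and
   the three conclusions are immediate.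

   The symmetries of R follow from the lowered coordinate expression
     R_ijkm = (d_i d_k g_jm - d_i d_m g_jk - d_j d_k g_im + d_j d_m g_ik) / 2
              - g(Gamma_jk, Gamma_im) + g(Gamma_ik, Gamma_jm),
   whose second-order part uses the equality of mixed partial derivatives. *)

Set Implicit Arguments.
Unset Strict Implicit.
Unset Printing Implicit Defensive.

(** * Linear forms given as plain functions *)

Lemma scalar_subZ (K : realType) (n : nat) (f : 'rV[K]_n -> K) :
  scalar f -> forall a u v, f (u - a *: v) = f u - a * f v.
Proof.
move=> lf a u v; rewrite -scaleNr addrC lf; ring.
Qed.

(** The argument has the shape of [wedge_endo], so this expands any linear slot filled by such a
    value. *)
Lemma scalar_lin2 (K : realType) (n : nat) (f : 'rV[K]_n -> K) :
  scalar f -> forall a u b v, f (a *: u - b *: v) = a * f u - b * f v.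
Proof.
move=> lf a u b v; rewrite (scalar_subZ lf); congr (_ - _).
have -> : a *: u = u - (1 - a) *: u by rewrite scalerBl scale1r subKr.
by rewrite (scalar_subZ lf); ring.
Qed.

Lemma scalarN (K : realType) (n : nat) (f : 'rV[K]_n -> K) :
  scalar f -> forall u, f (- u) = - f u.
Proof.
move=> lf u; have -> : - u = u - 2 *: u by rewrite scaler_nat mulr2n opprD addNKr.
by rewrite scalar_subZ //; ring.
Qed.

Lemma scalar_sum (K : realType) (n : nat) (I : Type) (r : seq I)
    (F : I -> 'rV[K]_n -> K) :
  (forall i, scalar (F i)) -> scalar (fun y => \sum_(i <- r) F i y).
Proof.
move=> lF k u v; rewrite mulr_sumr -big_split.
by apply: eq_bigr => i _; rewrite lF.
Qed.

(** * Traces with respect to a scalar product *)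

Section MetricTrace.
Variables (K : realType) (n : nat) (G : 'M[K]_n).
Local Notation V := 'rV[K]_n.
Local Notation tr := (trace_form G).
Local Notation g := (ip G).

Lemma eq_trace_form (A B : V -> V -> K) :
  (forall u v, A u v = B u v) -> tr A = tr B.
Proof.
by move=> AB; apply: eq_bigr => a _; apply: eq_bigr => b _; rewrite AB.
Qed.

Lemma trace_formD (A B : V -> V -> K) :
  tr (fun u v => A u v + B u v) = tr A + tr B.
Proof.
rewrite /trace_form -big_split; apply: eq_bigr => a _.
by rewrite -big_split; apply: eq_bigr => b _; rewrite mulrDr.
Qed.

Lemma trace_formZ k (A : V -> V -> K) : tr (fun u v => k * A u v) = k * tr A.
Proof.
rewrite /trace_form mulr_sumr; apply: eq_bigr => a _.
by rewrite mulr_sumr; apply: eq_bigr => b _; rewrite mulrCA.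
Qed.

Lemma trace_form_exchange (F : V -> V -> V -> V -> K) :
  tr (fun u v => tr (fun a b => F u v a b)) =
  tr (fun a b => tr (fun u v => F u v a b)).
Proof.
rewrite /trace_form.
under eq_bigr => i _ do under eq_bigr => j _ do rewrite mulr_sumr.
under eq_bigr => i _ do rewrite exchange_big.
rewrite exchange_big; apply: eq_bigr => k _.
under eq_bigr => i _ do under eq_bigr => j _ do rewrite mulr_sumr.
under eq_bigr => i _ do rewrite exchange_big.
rewrite exchange_big; apply: eq_bigr => l _.
rewrite mulr_sumr; apply: eq_bigr => i _.
by rewrite mulr_sumr; apply: eq_bigr => j _; rewrite mulrCA.
Qed.

Lemma scalar_trace_form (F : V -> V -> V -> K) :
  (forall u v, scalar (fun x => F x u v)) ->
  scalar (fun x => tr (fun u v => F x u v)).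
Proof.
move=> lF k x y; rewrite -trace_formZ -trace_formD.
by apply: eq_trace_form => u v; rewrite lF.
Qed.

Lemma scalar_sum_delta (L : V -> K) (x : V) : scalar L ->
  L x = \sum_a x 0 a * L (delta_mx 0 a).
Proof.
move=> lL.
(* Packing L as a bundled linear map gives access to [linear_sum] and [linearZ]. *)
pose L' := HB.pack_for {linear V -> K^o} (L : V -> K^o)
  (GRing.isLinear.Build _ _ _ _ (L : V -> K^o) lL).
rewrite [in LHS](row_sum_delta x) -[L _]/(L' _) linear_sum.
by apply: eq_bigr => a _; rewrite linearZ.
Qed.

Lemma ip_scalarl Y : scalar (fun X => g X Y).
Proof. by move=> k x y; rewrite /ip !mulmxDl -!scalemxAl !mxE. Qed.

Lemma ip_scalarr X : scalar (g X).
Proof. by move=> k x y; rewrite /ip linearP mulmxDr -!scalemxAr !mxE. Qed.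

Hypothesis uG : G \in unitmx.
Hypothesis symG : G^T = G.

Lemma ipC X Y : g X Y = g Y X.
Proof.
by rewrite /ip -[in LHS](trmxK (X *m G *m Y^T)) mxE !trmx_mul trmxK symG mulmxA.
Qed.

Lemma trace_formC (A : V -> V -> K) : tr (fun u v => A v u) = tr A.
Proof.
rewrite /trace_form exchange_big; apply: eq_bigr => a _; apply: eq_bigr => b _.
by rewrite -[in LHS]symG -trmx_inv mxE.
Qed.

(** The coordinates of Y are those of G^-1 (G Y^T), so contracting with g(., Y) substitutes Y into
    L. Together with [trace_form_ipl] and [trace_form_ip], this evaluates the traces that involve
    g. *)
Lemma trace_form_ipr (L : V -> K) (lL : scalar L) Y :
  tr (fun u v => L u * g v Y) = L Y.
Proof.
rewrite (scalar_sum_delta Y lL); apply: eq_bigr => a _.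
have -> : Y 0 a = (invmx G *m (G *m Y^T)) a 0 by rewrite mulKmx // mxE.
rewrite mxE mulr_suml; apply: eq_bigr => b _.
rewrite mulrAC mulrA; congr (_ * _ * _).
by rewrite /ip -mulmxA -rowE mxE.
Qed.

Lemma trace_form_ipl (L : V -> K) (lL : scalar L) Y :
  tr (fun u v => L v * g u Y) = L Y.
Proof. by rewrite (trace_formC (fun u v => L u * g v Y)) trace_form_ipr. Qed.

Lemma trace_form_ip : tr g = n%:R.
Proof.
rewrite /trace_form (eq_bigr (fun=> 1)) => [|a _].
  by rewrite sumr_const card_ord.
transitivity ((invmx G *m G) a a); last by rewrite mulVmx // mxE eqxx.
rewrite mxE; apply: eq_bigr => b _; congr (_ * _).
by rewrite ipC /ip -rowE trmx_delta -colE !mxE.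
Qed.
End MetricTrace.

(** Polarization: B(x + y, x + y) = 0 reduces to 2 B(x, y) = 0. The factor 1 in [1 *: x + y] lets
    the [scalar] hypothesis rewrite directly. *)
Lemma eq0_of_diag (K : realType) (n : nat) (B : form2 K n) :
  (forall y, scalar (fun x => B x y)) -> (forall x y, B x y = B y x) ->
  (forall x, B x x = 0) -> forall x y, B x y = 0.
Proof.
move=> Bl BC B0 x y; have := B0 (1 *: x + y).
by rewrite Bl BC Bl B0 (BC y (_ + _)) Bl B0 (BC y x) => ?; lra.
Qed.

Lemma Q2_ipE (K : realType) (n : nat) (G : 'M[K]_n) (S : form2 K n) x y z w :
  Q2 S (ip G) x y z w =
  - (S w x * ip G z y - S z x * ip G w y)
  - (S w y * ip G x z - S z y * ip G x w).
Proof.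
by rewrite /Q2 /act2 (scalar_lin2 (ip_scalarl G _)) (scalar_lin2 (ip_scalarr G _)).
Qed.

(** * Contractions of the cyclic identity *)

Section CyclicIdentity.
Variables (K : realType) (n : nat) (G : 'M[K]_n).
Local Notation V := 'rV[K]_n.
Local Notation tr := (trace_form G).
Local Notation g := (ip G).
Hypothesis uG : G \in unitmx.
Hypothesis symG : G^T = G.
Variables (S : form2 K n) (T : form4 K n).
Hypothesis Sl : forall y, scalar (fun x => S x y).
Hypothesis SC : forall x y, S x y = S y x.
Hypothesis T1 : forall y z w, scalar (fun x => T x y z w).
Hypothesis T2 : forall x z w, scalar (fun y => T x y z w).
Hypothesis T3 : forall x y w, scalar (fun z => T x y z w).
Hypothesis T4 : forall x y z, scalar (T x y z).
Hypothesis TC : forall x y z w, T x y z w = T y x z w.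
Hypothesis TN : forall x y z w, T x y z w = - T x y w z.

Local Notation q := (Q2 S g).

(* With T = R.S this is wedge_(R.S) - c (wedge_S . wedge_S). *)
Definition wedge_defect (c : K) (x1 x2 x3 x4 x5 x6 : V) : K :=
  T x2 x3 x5 x6 * g x1 x4 - T x1 x3 x5 x6 * g x2 x4 -
  c * (S x2 x3 * q x1 x4 x5 x6 - S x1 x3 * q x2 x4 x5 x6).

Variable c : K.
Hypothesis H : forall x1 x2 x3 x4 x5 x6, wedge_defect c x1 x2 x3 x4 x5 x6
  + wedge_defect c x3 x4 x5 x6 x1 x2 + wedge_defect c x5 x6 x1 x2 x3 x4 = 0.

(** The trace U of the overview. *)
Definition contract13 x y := tr (fun u v => T u x v y).
(** The tensor S^2, written as a trace so that it appears directly when products of two values of S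
    are contracted. *)
Definition form_sq x y := tr (fun u v => S u x * S v y).
Local Notation kap := (tr S).
Let gC := ipC symG.

Lemma form_sqC x y : form_sq x y = form_sq y x.
Proof.
rewrite /form_sq -(trace_formC symG); apply: eq_trace_form => u v.
by rewrite mulrC.
Qed.

Let contract13Et x y : tr (fun u v => T v x u y) = contract13 x y.
Proof. by rewrite /contract13 -(trace_formC symG). Qed.

(** A folding rule for the multi-rewrites below, as is [contract13E]. *)
Let form_sqE x y : tr (fun u v => S u x * S v y) = form_sq x y.
Proof. by []. Qed.

Let contract13E x y : tr (fun u v => T u x v y) = contract13 x y.
Proof. by []. Qed.

(* The trace of the hypothesis over x1 and x4. *)
Lemma contraction14 x2 x3 x5 x6 :
  (n%:R - 1) * T x2 x3 x5 x6 - T x3 x5 x6 x2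
  + contract13 x5 x2 * g x3 x6 - contract13 x6 x3 * g x2 x5
  + contract13 x5 x3 * g x2 x6 =
  c * ((n%:R + 1) * (S x2 x6 * S x3 x5) - 2 * (S x2 x5 * S x3 x6)
  - S x2 x3 * S x5 x6 + form_sq x3 x6 * g x2 x5 + form_sq x5 x6 * g x2 x3
  - form_sq x2 x6 * g x3 x5 + form_sq x2 x5 * g x3 x6
  - kap * S x3 x5 * g x2 x6).
Proof.
(* [ord2] and [ordu] put the arguments of a symmetric form in one fixed order, with u and v before
   the x's, so that equal terms become syntactically equal. *)
pose ord2 (F : form2 K n) (FC : forall x y, F x y = F y x) :=
  (FC x3 x2, FC x5 x2, FC x6 x2, FC x5 x3, FC x6 x3, FC x6 x5).
pose ordu (F : form2 K n) (FC : forall x y, F x y = F y x) u :=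
  (FC x2 u, FC x3 u, FC x5 u, FC x6 u).
(* Every summand has the shape (constant * form in u, v), which the trace rules
   below can read; hence -1 * _ and 0 * 1. *)
have key u v :
  (T x2 x3 x5 x6 * g u v + -1 * (T u x3 x5 x6 * g v x2)
  + g x3 x6 * T v x5 u x2 + -1 * (T x3 x5 u x2 * g v x6)
  + - g x2 x5 * T u x6 v x3 + g x2 x6 * T u x5 v x3)
  + - c * (
   - S x2 x3 * (S u x6 * g v x5) + S x2 x3 * (S u x5 * g v x6)
   + - S x2 x3 * (S v x6 * g u x5) + S x2 x3 * (S v x5 * g u x6)
   + S x2 x6 * (S u x3 * g v x5) + - S x2 x5 * (S u x3 * g v x6)
   + g x2 x5 * (S u x3 * S v x6) + - g x2 x6 * (S u x3 * S v x5)
   + - S x2 x3 * (S v x5 * g u x6) + g x2 x6 * (S u x3 * S v x5)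
   + - S x2 x6 * (S v x5 * g u x3) + g x2 x3 * (S u x6 * S v x5)
   + S x3 x5 * (S v x2 * g u x6) + - (S x3 x5 * g x2 x6) * S u v
   + S x3 x5 * S x2 x6 * g u v + - S x3 x5 * (S u x6 * g v x2)
   + - g x2 x3 * (S u x6 * S v x5) + S x3 x5 * (S u x6 * g v x2)
   + - g x3 x5 * (S u x6 * S v x2) + S x2 x3 * (S u x6 * g v x5)
   + g x2 x3 * (S u x5 * S v x6) + - S x3 x6 * (S u x5 * g v x2)
   + g x3 x6 * (S u x5 * S v x2) + - S x2 x3 * (S u x5 * g v x6))
  = 0 * 1.
  transitivity (wedge_defect c u x2 x3 v x5 x6 +
    wedge_defect c x3 v x5 x6 u x2 + wedge_defect c x5 x6 u x2 x3 v);
    last by rewrite H mul0r.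
  rewrite /wedge_defect !Q2_ipE.
  (* The symmetries of T bring u and v to slots 1 and 3, the slots contracted by [contract13]. *)
  rewrite (TC x6 u x3 v) (TC x5 u x3 v) (TN u x6 x3 v) (TN u x5 x3 v).
  rewrite !(ord2 S SC, ord2 g gC, ordu S SC u, ordu S SC v, ordu g gC u,
    ordu g gC v, SC v u, gC v u).
  ring.
have := eq_trace_form G key.
rewrite !(trace_formD, trace_formZ).
rewrite !(trace_form_ipr uG (T1 _ _ _), trace_form_ipr uG (T3 _ _ _),
  trace_form_ipr uG (Sl _), trace_form_ipl uG symG (Sl _),
  trace_form_ip uG symG, contract13Et, contract13E, form_sqE).
rewrite !(ord2 S SC, ord2 g gC, ord2 form_sq form_sqC) mul0r => e.
by apply/eqP; rewrite -subr_eq0; apply/eqP; rewrite -[RHS]e; ring.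
Qed.

Let T0 x y z : T x y z z = 0.
Proof. by have := TN x y z z; lra. Qed.

Let form_sq_scalarl y : scalar (fun x => form_sq x y).
Proof.
apply: scalar_trace_form => u v k x z.
by rewrite SC Sl !(SC _ u); ring.
Qed.

Let contract13_scalarr x : scalar (contract13 x).
Proof. by apply: scalar_trace_form => u v k y z; rewrite T4. Qed.

Let contract13_scalarl y : scalar (fun x => contract13 x y).
Proof. by apply: scalar_trace_form => u v k x z; rewrite T2. Qed.

Lemma contraction14_diag x : contract13 x x * g x x =
  c * ((n%:R - 2) * S x x ^+ 2 + 2 * form_sq x x * g x x - kap * S x x * g x x).
Proof.
by have := contraction14 x x x x; rewrite !T0 => e; lra.
Qed.

(** With x5 = x6 = x, the terms [T v x u x] and [contract13 x u * g v x] each contribute one U; the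
    right side is doubled as well, and the factor 2 cancels. *)
Lemma contraction14_23 x :
  contract13 x x = c * (n%:R * form_sq x x - kap * S x x).
Proof.
have key u v :
  T v x u x + contract13 x u * g v x +
  - c * ((n%:R - 1) * (S u x * S v x) + - S x x * S u v + form_sq v x * g u x
     + form_sq x x * g u v + - kap * (S v x * g u x)) = 0 * 1.
  have := contraction14 u v x x.
  rewrite T0 (TN v x x) => e; lra.
have := eq_trace_form G key.
rewrite !(trace_formD, trace_formZ).
rewrite !(trace_form_ipr uG (contract13_scalarr _),
  trace_form_ipl uG symG (form_sq_scalarl _), trace_form_ipl uG symG (Sl _),
  trace_form_ip uG symG, contract13Et, form_sqE) => e.
lra.
Qed.

(** Exchanging the two traces swaps slots 1, 2 and slots 3, 4 of T simultaneously; the first swap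
    preserves T and the second changes its sign. *)
Let trace_contract13 : tr contract13 = 0.
Proof.
suff : tr contract13 = - tr contract13 by lra.
rewrite -mulN1r -trace_formZ.
rewrite {1}/contract13 trace_form_exchange.
apply: eq_trace_form => u v; rewrite -trace_formZ.
by apply: eq_trace_form => a b; rewrite TC TN mulN1r.
Qed.

(** With x3 = x6 = x, the coefficients n - 1, 1, -n and 1 of U add up to 1, and the term in tr U
    drops out by [trace_contract13]. *)
Lemma contraction14_25 x :
  contract13 x x =
  c * (2 * n%:R * form_sq x x - 3 * kap * S x x + tr form_sq * g x x).
Proof.
have key u v :
  (n%:R - 1) * T u x v x + T v x u x + g x x * contract13 v u
   + - contract13 x x * g u v + contract13 v x * g u x +
  - c * (n%:R * (S u x * S v x) + - (2 * S x x) * S u v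
     + form_sq x x * g u v + form_sq v x * g u x + -1 * (form_sq u x * g v x)
     + g x x * form_sq u v + - kap * (S v x * g u x)) = 0 * 1.
  have := contraction14 u x v x.
  rewrite (TC x v x) (TN v x x) (SC x v) (gC x v) => e; lra.
have := eq_trace_form G key.
rewrite !(trace_formD, trace_formZ) (trace_formC symG contract13).
rewrite trace_contract13.
rewrite !(trace_form_ipr uG (form_sq_scalarl _),
  trace_form_ipl uG symG (form_sq_scalarl _),
  trace_form_ipl uG symG (contract13_scalarl _), trace_form_ipl uG symG (Sl _),
  trace_form_ip uG symG, contract13Et, contract13E, form_sqE) => e.
lra.
Qed.

Hypothesis c_neq0 : c != 0.
Hypothesis n_gt2 : (2 < n)%N.

Lemma einstein_of_wedge_defect x y : S x y = kap / n%:R * g x y.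
Proof.
have n0 : n%:R != 0 :> K by rewrite pnatr_eq0; case: n n_gt2.
have n20 : n%:R - 2 != 0 :> K.
  by rewrite subr_eq0 eqr_nat; case: n n_gt2 => [|[|[|]]].
(* The difference of the two values of U(z, z). *)
have quad z : n%:R * form_sq z z - 2 * kap * S z z + tr form_sq * g z z = 0.
  apply: (mulfI c_neq0).
  have := contraction14_23 z; have := contraction14_25 z; lra.
have trace_form_sq : n%:R * tr form_sq = kap ^+ 2.
  have key u v :
    n%:R * form_sq u v + - (2 * kap) * S u v + tr form_sq * g u v = 0 * 1.
    (* [quad] is known on the diagonal only; polarization makes it an identity of forms, which can
       be traced. *)
    pose B u v :=
      n%:R * form_sq u v + - (2 * kap) * S u v + tr form_sq * g u v.
    rewrite mul0r -/(B u v); apply: eq0_of_diag.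
    - by move=> w k a b;
        rewrite /B form_sq_scalarl Sl (ip_scalarl G w k a b); ring.
    - by move=> a b; rewrite /B form_sqC SC gC.
    - by move=> a; rewrite /B -[RHS](quad a); ring.
  have := eq_trace_form G key.
  rewrite !(trace_formD, trace_formZ) (trace_form_ip uG symG); lra.
(* Inserting U = c (n q - k s) into [contraction14_diag] leaves (n - 2) (s^2 - q N) = 0 up to the
   factor c; n > 2 makes n - 2 invertible. *)
have square z : S z z ^+ 2 = form_sq z z * g z z.
  apply: (mulfI n20); apply: (mulfI c_neq0).
  have := contraction14_diag z; rewrite contraction14_23; lra.
have diag z : n%:R * S z z - kap * g z z = 0.
  apply/eqP; rewrite -sqrf_eq0; apply/eqP.
  (* (n s - k N)^2 as a combination of the three quantities just shown to vanish. *)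
  transitivity (n%:R * g z z
      * (n%:R * form_sq z z - 2 * kap * S z z + tr form_sq * g z z)
    + n%:R ^+ 2 * (S z z ^+ 2 - form_sq z z * g z z)
    - (n%:R * tr form_sq - kap ^+ 2) * g z z ^+ 2); first by ring.
  by rewrite quad square trace_form_sq !subrr; ring.
apply/(mulfI n0)/eqP; rewrite -subr_eq0; apply/eqP.
transitivity (n%:R * S x y - kap * g x y); first by field.
pose B u v := n%:R * S u v - kap * g u v.
rewrite -/(B x y); apply: eq0_of_diag.
- by move=> w k a b; rewrite /B Sl (ip_scalarl G w k a b); ring.
- by move=> a b; rewrite /B SC gC.
- exact: diag.
Qed.
End CyclicIdentity.

(** * The projective tensor of an algebraic curvature tensor *)

Section AlgebraicCurvature.
Variables (K : realType) (n : nat) (G : 'M[K]_n).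
Local Notation V := 'rV[K]_n.
Local Notation g := (ip G).
Hypothesis uG : G \in unitmx.
Hypothesis symG : G^T = G.

Lemma ip_sharp_scalar (a : V -> K) Y : scalar a -> g (sharp G a) Y = a Y.
Proof.
move=> la.
pose a' := HB.pack_for {linear V -> K^o} (a : V -> K^o)
  (GRing.isLinear.Build _ _ _ _ (a : V -> K^o) la).
exact: (ip_sharp a' Y uG).
Qed.

(** Nondegeneracy of g; it reduces identities between vectors, such as values of [curv_endo], to
    identities between scalars. *)
Lemma ip_inj X Y : (forall Z, g X Z = g Y Z) -> X = Y.
Proof.
move=> XY; apply: (can_inj (mulmxK uG)); apply/rowP => b.
have := XY (delta_mx 0 b).
by rewrite /ip trmx_delta -!colE !mxE.
Qed.

Variable R : form4 K n.
Hypothesis R1 : forall y z w, scalar (fun x => R x y z w).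
Hypothesis R2 : forall x z w, scalar (fun y => R x y z w).
Hypothesis R3 : forall x y w, scalar (fun z => R x y z w).
Hypothesis R4 : forall x y z, scalar (R x y z).
Hypothesis R12 : forall x y z w, R x y z w = - R y x z w.
Hypothesis R34 : forall x y z w, R x y z w = - R x y w z.
Hypothesis Rpair : forall x y z w, R x y z w = R z w x y.

Local Notation S := (ricci G R).
Local Notation E := (curv_endo G R).
Local Notation T := (dot2 G R S).

Lemma ip_curv_endo x y z w : g (E x y z) w = R x y z w.
Proof. exact: ip_sharp_scalar. Qed.

Lemma ricciC x y : S x y = S y x.
Proof.
rewrite /ricci -(trace_formC symG); apply: eq_trace_form => u v.
by rewrite Rpair R12 R34 opprK.
Qed.

Lemma ricci_scalarl y : scalar (fun x => S x y).
Proof. by apply: scalar_trace_form => u v; exact: R2. Qed.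

Lemma ricci_scalarr x : scalar (S x).
Proof. by apply: scalar_trace_form => u v; exact: R3. Qed.

Lemma curv_endo1 y z k x x' : E (k *: x + x') y z = k *: E x y z + E x' y z.
Proof. by apply: ip_inj => w; rewrite (ip_scalarl G w) !ip_curv_endo R1. Qed.

Lemma curv_endo3 x y k z z' : E x y (k *: z + z') = k *: E x y z + E x y z'.
Proof. by apply: ip_inj => w; rewrite (ip_scalarl G w) !ip_curv_endo R3. Qed.

Lemma curv_endoN x y z : E x y z = - E y x z.
Proof.
apply: ip_inj => w.
by rewrite (scalarN (ip_scalarl G w)) !ip_curv_endo R12.
Qed.

Lemma dot_ricciE x y z w : T x y z w = - S (E z w x) y - S (E z w y) x.
Proof. by rewrite /dot2 /act2 (ricciC x). Qed.

Lemma dot_ricci1 y z w : scalar (fun x => T x y z w).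
Proof.
move=> k a b; rewrite !dot_ricciE curv_endo3 ricci_scalarl.
by rewrite ricci_scalarr; ring.
Qed.

Lemma dot_ricciC x y z w : T x y z w = T y x z w.
Proof. by rewrite !dot_ricciE; ring. Qed.

Lemma dot_ricci2 x z w : scalar (fun y => T x y z w).
Proof. by move=> k a b; rewrite !(dot_ricciC x) dot_ricci1. Qed.

Lemma dot_ricci3 x y w : scalar (fun z => T x y z w).
Proof.
by move=> k a b; rewrite !dot_ricciE !curv_endo1 !ricci_scalarl; ring.
Qed.

Lemma dot_ricciN x y z w : T x y z w = - T x y w z.
Proof.
rewrite !dot_ricciE !(curv_endoN w z) !(scalarN (ricci_scalarl _)); ring.
Qed.

Lemma dot_ricci4 x y z : scalar (T x y z).
Proof. by move=> k a b; rewrite !(dot_ricciN x y z) dot_ricci3; ring. Qed.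

Lemma sharp_ip X : sharp G (g X) = X.
Proof. by apply: ip_inj => w; rewrite ip_sharp_scalar //; exact: ip_scalarr. Qed.

Local Notation q := (Q2 S g).

Lemma curv_endo_wedge x y z :
  curv_endo G (wedge_ricci G R) x y z = wedge_endo S x y z.
Proof. exact: sharp_ip. Qed.

Lemma wedge_ricciE x y z w :
  wedge_ricci G R x y z w = S y z * g x w - S x z * g y w.
Proof. by rewrite /wedge_ricci (scalar_lin2 (ip_scalarl G w)). Qed.

Lemma wedge_lin2 (f : V -> K) (lf : scalar f) x y z :
  f (wedge_endo S x y z) = S y z * f x - S x z * f y.
Proof. exact: scalar_lin2. Qed.

(** The endomorphism of wedge_S acts as a derivation on products of S and g, and it kills S because
    Q(S, S) = 0. Only the factors g contribute. *)
Lemma dot_wedge_wedge x1 x2 x3 x4 x y :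
  dot4 G (wedge_ricci G R) (wedge_ricci G R) x1 x2 x3 x4 x y =
  S x2 x3 * q x1 x4 x y - S x1 x3 * q x2 x4 x y.
Proof.
rewrite /dot4 /act4 !wedge_ricciE !curv_endo_wedge !Q2_ipE.
rewrite !(wedge_lin2 (ip_scalarl G _), wedge_lin2 (ip_scalarr G _),
  wedge_lin2 (ricci_scalarl _), wedge_lin2 (ricci_scalarr _)).
by rewrite (ricciC x2 x) (ricciC x2 y) (ricciC x1 x) (ricciC x1 y); ring.
Qed.

Local Notation c := ((n%:R - 1)^-1 : K).
Local Notation P := (projective G R).

Lemma projectiveE x y z w : P x y z w = R x y z w - c * wedge_ricci G R x y z w.
Proof. by rewrite wedge_ricciE. Qed.

Lemma curv_endo_projective x y z :
  curv_endo G P x y z = E x y z - c *: wedge_endo S x y z.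
Proof.
apply: ip_inj => w; rewrite ip_sharp_scalar => [|k u v]; last first.
  by rewrite !projectiveE R4 /wedge_ricci (ip_scalarr G _); ring.
by rewrite (scalar_subZ (ip_scalarl G w)) ip_curv_endo projectiveE.
Qed.

Lemma endo_lin2 (f : V -> K) (lf : scalar f) x y z :
  f (E x y z - c *: wedge_endo S x y z) =
  f (E x y z) - c * (S y z * f x - S x z * f y).
Proof. by rewrite (scalar_subZ lf) (wedge_lin2 lf). Qed.

(** D . H is linear in D and in H, and R . wedge_S = wedge_(R.S) because R . g = 0; the final
    rewrites with [R34] express the latter. *)
Lemma dot_projective x1 x2 x3 x4 x y :
  dot4 G P P x1 x2 x3 x4 x y =
  dot4 G R R x1 x2 x3 x4 x y - c * dot4 G (wedge_ricci G R) R x1 x2 x3 x4 x y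
  - c * wedge_defect G S T c x1 x2 x3 x4 x y.
Proof.
rewrite /wedge_defect -dot_wedge_wedge.
rewrite /dot4 /act4 !curv_endo_projective !curv_endo_wedge !projectiveE.
rewrite !(wedge_ricciE, dot_ricciE).
rewrite !(endo_lin2 (R1 _ _ _), endo_lin2 (R2 _ _ _), endo_lin2 (R3 _ _ _),
  endo_lin2 (R4 _ _ _), endo_lin2 (ip_scalarl G _), endo_lin2 (ip_scalarr G _),
  endo_lin2 (ricci_scalarl _), endo_lin2 (ricci_scalarr _)).
rewrite !(wedge_lin2 (R1 _ _ _), wedge_lin2 (R2 _ _ _), wedge_lin2 (R3 _ _ _),
  wedge_lin2 (R4 _ _ _),
  wedge_lin2 (ip_scalarl G _), wedge_lin2 (ip_scalarr G _),
  wedge_lin2 (ricci_scalarl _), wedge_lin2 (ricci_scalarr _)).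
rewrite !(ipC symG _ (E _ _ _)) !(ricciC _ (E _ _ _)) !ip_curv_endo.
rewrite (R34 x y x4 x1) (R34 x y x4 x2).
ring.
Qed.

(* Pair symmetry turns every summand into a scalar product of two values of E,
   and these cancel in the cyclic sum. *)
Lemma dot_curvature_curvature x1 x2 x3 x4 x y :
  dot4 G R R x1 x2 x3 x4 x y =
  g (E x3 x4 x2) (E x y x1) - g (E x3 x4 x1) (E x y x2)
  + g (E x1 x2 x4) (E x y x3) - g (E x1 x2 x3) (E x y x4).
Proof.
rewrite /dot4 /act4 (Rpair (E _ _ _)) (Rpair x1 (E _ _ _)).
by rewrite (R34 _ _ (E _ _ _) x2) (R34 _ _ (E _ _ _) x4) !ip_curv_endo; ring.
Qed.

Lemma dot_curvature_cyclic x1 x2 x3 x4 x5 x6 :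
  dot4 G R R x1 x2 x3 x4 x5 x6 + dot4 G R R x3 x4 x5 x6 x1 x2
  + dot4 G R R x5 x6 x1 x2 x3 x4 = 0.
Proof.
rewrite !dot_curvature_curvature.
rewrite !(ipC symG (E x5 x6 _)) !(ipC symG (E x3 x4 _) (E x1 x2 _)).
by ring.
Qed.

Lemma dot_wedge_cyclic x1 x2 x3 x4 x5 x6 :
  let WR := dot4 G (wedge_ricci G R) R in
  WR x1 x2 x3 x4 x5 x6 + WR x3 x4 x5 x6 x1 x2 + WR x5 x6 x1 x2 x3 x4 = 0.
Proof.
rewrite /dot4 /act4 !curv_endo_wedge.
rewrite !(wedge_lin2 (R1 _ _ _), wedge_lin2 (R2 _ _ _), wedge_lin2 (R3 _ _ _),
  wedge_lin2 (R4 _ _ _)).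
(* Each value of R contains exactly one intact pair among (x1, x2), (x3, x4), (x5, x6). That pair is
   moved to the front and the other two arguments are ordered by index; after the same ordering in
   S, the terms cancel. *)
rewrite !(Rpair _ _ x3 x4, Rpair _ _ x5 x6, Rpair _ _ x1 x2).
rewrite !(R34 _ _ x5 x2, R34 _ _ x6 x2, R34 _ _ x5 x1, R34 _ _ x6 x1,
  R34 _ _ x5 x4, R34 _ _ x6 x4, R34 _ _ x5 x3, R34 _ _ x6 x3,
  R34 _ _ x4 x1, R34 _ _ x4 x2, R34 _ _ x3 x1, R34 _ _ x3 x2).
rewrite (ricciC x6 x1) (ricciC x6 x2) (ricciC x6 x3) (ricciC x6 x4)
  (ricciC x5 x1) (ricciC x5 x2) (ricciC x5 x3) (ricciC x5 x4)
  (ricciC x4 x1) (ricciC x4 x2) (ricciC x3 x1) (ricciC x3 x2).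
ring.
Qed.

Lemma dot_projective_cyclic x1 x2 x3 x4 x5 x6 :
  let PP := dot4 G P P in let H := wedge_defect G S T c in
  PP x1 x2 x3 x4 x5 x6 + PP x3 x4 x5 x6 x1 x2 + PP x5 x6 x1 x2 x3 x4 =
  - c * (H x1 x2 x3 x4 x5 x6 + H x3 x4 x5 x6 x1 x2 + H x5 x6 x1 x2 x3 x4).
Proof.
rewrite /= !dot_projective.
have := dot_curvature_cyclic x1 x2 x3 x4 x5 x6.
have /= := dot_wedge_cyclic x1 x2 x3 x4 x5 x6.
set w1 := dot4 _ (wedge_ricci _ _) _ _ _ _ _ _ _.
set w2 := dot4 _ (wedge_ricci _ _) _ _ _ _ _ _ _.
set w3 := dot4 _ (wedge_ricci _ _) _ _ _ _ _ _ _.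
move=> W RR.
transitivity (- c * (w1 + w2 + w3) + 0
  - c * (wedge_defect G S T c x1 x2 x3 x4 x5 x6
    + wedge_defect G S T c x3 x4 x5 x6 x1 x2
    + wedge_defect G S T c x5 x6 x1 x2 x3 x4)).
  by rewrite -RR; ring.
by rewrite W; ring.
Qed.

Lemma cyclic_of_wedge :
  (forall x1 x2 x3 x4 x y, wedge_R_ricci G R x1 x2 x3 x4 x y =
    c * dot4 G (wedge_ricci G R) (wedge_ricci G R) x1 x2 x3 x4 x y) ->
  forall x1 x2 x3 x4 x5 x6, let PP := dot4 G P P in
  PP x1 x2 x3 x4 x5 x6 + PP x3 x4 x5 x6 x1 x2 + PP x5 x6 x1 x2 x3 x4 = 0.
Proof.
move=> W x1 x2 x3 x4 x5 x6 /=; rewrite dot_projective_cyclic.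
have H0 y1 y2 y3 y4 y5 y6 : wedge_defect G S T c y1 y2 y3 y4 y5 y6 = 0.
  have := W y1 y2 y3 y4 y5 y6.
  by rewrite dot_wedge_wedge /wedge_R_ricci => e; rewrite /wedge_defect e subrr.
by rewrite !H0 !addr0 mulr0.
Qed.

Lemma ricci_of_cyclic : (2 < n)%N ->
  (forall x1 x2 x3 x4 x5 x6, let PP := dot4 G P P in
  PP x1 x2 x3 x4 x5 x6 + PP x3 x4 x5 x6 x1 x2 + PP x5 x6 x1 x2 x3 x4 = 0) ->
  forall x y, S x y = scalar_curvature G R / n%:R * g x y.
Proof.
move=> n_gt2 PP0.
have c0 : c != 0.
  by rewrite invr_eq0 subr_eq0 pnatr_eq1; case: n n_gt2 => [|[]].
apply: (einstein_of_wedge_defect uG symG ricci_scalarl ricciC dot_ricci1 dot_ricci2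
  dot_ricci3 dot_ricci4 dot_ricciC dot_ricciN (c := c)) => //.
move=> x1 x2 x3 x4 x5 x6; have /eqP := PP0 x1 x2 x3 x4 x5 x6.
by rewrite dot_projective_cyclic mulf_eq0 oppr_eq0 (negPf c0) => /eqP.
Qed.

(** From S = (k/n) g follows S^2 = (k/n)^2 g. In the first identity both sides vanish, as R . g = 0
    and Q(g, g) = 0; in the second both equal (k/n)^2 times the product of g with itself; the third
    becomes (k^2 - 2 k^2 + k^2) g = 0. *)
Lemma einstein_conclusions : (2 < n)%N ->
  (forall x y, S x y = scalar_curvature G R / n%:R * g x y) ->
  [/\ forall x1 x2 x y, n%:R * (n%:R - 1) * T x1 x2 x y =
        scalar_curvature G R * Q2 g S x1 x2 x y,
      forall x1 x2 x3 x4, kulkarni_nomizu S S x1 x2 x3 x4 =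
        kulkarni_nomizu g (ricci_sq G R) x1 x2 x3 x4
    & forall x y, n%:R ^+ 2 * ricci_sq G R x y
        - 2 * n%:R * scalar_curvature G R * S x y
        + scalar_curvature G R ^+ 2 * g x y = 0].
Proof.
move=> n_gt2 SE.
have n0 : n%:R != 0 :> K by rewrite pnatr_eq0; case: n n_gt2.
have sqE x y : ricci_sq G R x y = (scalar_curvature G R / n%:R) ^+ 2 * g x y.
  have opE z w : g (ricci_operator G R z) w = S z w.
    exact: ip_sharp_scalar (ricci_scalarr _).
  by rewrite /ricci_sq opE SE opE SE; ring.
split=> [x1 x2 x y|x1 x2 x3 x4|x y].
- rewrite dot_ricciE !SE !ip_curv_endo (R34 x y x2 x1) /Q2 /act2 !SE.
  rewrite !(scalar_lin2 (ip_scalarl G _)) !(scalar_lin2 (ip_scalarr G _)).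
  by rewrite (ipC symG x1 x) (ipC symG x1 y); ring.
- by rewrite /kulkarni_nomizu !SE !sqE; ring.
- by rewrite sqE SE; field.
Qed.
End AlgebraicCurvature.

(** * Symmetry of mixed derivatives *)

Section Schwarz.
Local Open Scope classical_set_scope.
Variables (K : realType) (V : normedModType K).

(** Turns directional derivatives into derivatives of functions of one real variable, to which [MVT]
    applies. *)
Lemma is_derive_line (f : V -> K^o) (z u : V) (s : K) :
  derivable f (z + s *: u) u ->
  is_derive s 1 (fun t : K => f (z + t *: u)) ('D_u f (z + s *: u)).
Proof.
move=> df.
have E : (fun h : K => h^-1 *: (((fun t : K => f (z + t *: u)) \o shift s)
      (h *: (1 : K^o)) - f (z + s *: u))) =
    (fun h : K => h^-1 *: ((f \o shift (z + s *: u)) (h *: u) - f (z + s *: u))).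
  apply/funext => h /=; congr (_ *: (f _ - _)).
  by rewrite [h *: 1]mulr1 scalerDl addrCA.
split; last by rewrite /derive E.
by rewrite /derivable E.
Qed.

(** The second difference of f over the parallelogram with sides h u and h v. Its symmetry in u and
    v is the source of the symmetry of mixed derivatives. *)
Definition mixed_difference (f : V -> K^o) (x u v : V) (h : K) : K :=
  f (x + h *: u + h *: v) - f (x + h *: u) - f (x + h *: v) + f x.

Lemma mixed_differenceC f x u v h :
  mixed_difference f x u v h = mixed_difference f x v u h.
Proof. by rewrite /mixed_difference [x + _ + _]addrAC; ring. Qed.

(** Two applications of the mean value theorem: the mixed difference is phi(h) - phi(0), and the
    derivative of phi at the intermediate s is psi(h) - psi(0). *)
Lemma mixed_difference_mvt f x u v h : 0 < h ->
  (forall s t, 0 <= s <= h -> 0 <= t <= h ->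
    derivable f (x + s *: u + t *: v) u /\
    derivable ('D_u f : V -> K^o) (x + s *: u + t *: v) v) ->
  exists s t, [/\ 0 <= s <= h, 0 <= t <= h &
    mixed_difference f x u v h =
    h ^+ 2 * 'D_v ('D_u f : V -> K^o) (x + s *: u + t *: v)].
Proof.
move=> h0 df.
have h00 : 0 <= h <= h by rewrite ltW /=.
have h01 : 0 <= (0 : K) <= h by rewrite lexx ltW.
pose phi (s : K) : K^o := f (x + h *: v + s *: u) - f (x + s *: u).
have dphi s : 0 <= s <= h ->
  is_derive s 1 phi ('D_u f (x + h *: v + s *: u) - 'D_u f (x + s *: u)).
  move=> sh; apply: is_deriveB.
    by apply: is_derive_line; rewrite addrAC; apply: (df _ _ sh h00).1.
  by apply: is_derive_line; have := (df _ _ sh h01).1; rewrite scale0r addr0.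
have cphi : {within `[0, h], continuous phi}.
  apply: derivable_within_continuous => s; rewrite in_itv /= => sh.
  exact: (@ex_derive _ _ _ _ _ _ _ (dphi s sh)).
have [|s sI] := @MVT K phi (fun s => 'D_u f (x + h *: v + s *: u)
    - 'D_u f (x + s *: u)) 0 h h0 _ cphi.
  by move=> s; rewrite in_itv /= => /andP[s0 s1]; apply: dphi; rewrite !ltW.
have {sI}sh : 0 <= s <= h.
  by move: sI; rewrite in_itv /= => /andP[s0 s1]; rewrite !ltW.
rewrite subr0 => Ephi.
pose psi (t : K) : K^o := 'D_u f (x + s *: u + t *: v).
have dpsi t : 0 <= t <= h ->
  is_derive t 1 psi ('D_v ('D_u f : V -> K^o) (x + s *: u + t *: v)).
  by move=> th; apply: is_derive_line; apply: (df _ _ sh th).2.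
have cpsi : {within `[0, h], continuous psi}.
  apply: derivable_within_continuous => t; rewrite in_itv /= => th.
  exact: (@ex_derive _ _ _ _ _ _ _ (dpsi t th)).
have [|t tI] := @MVT K psi (fun t => 'D_v ('D_u f : V -> K^o)
    (x + s *: u + t *: v)) 0 h h0 _ cpsi.
  by move=> t; rewrite in_itv /= => /andP[t0 t1]; apply: dpsi; rewrite !ltW.
have {tI}th : 0 <= t <= h.
  by move: tI; rewrite in_itv /= => /andP[t0 t1]; rewrite !ltW.
rewrite subr0 => Epsi.
exists s, t; split => //.
move: Epsi; rewrite /psi scale0r addr0 => Epsi.
move: Ephi; rewrite /phi !scale0r !addr0 [x + h *: v + s *: u]addrAC => Ephi.
set X := 'D_v _ _ in Epsi *.
transitivity (h * (X * h)); last by rewrite expr2 -mulrA (mulrC X).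
rewrite -Epsi mulrC -Ephi.
rewrite /mixed_difference [x + h *: u + h *: v]addrAC.
by ring.
Qed.

(** For small h the mixed difference divided by h^2 is both a value of D_v D_u f and a value of D_u
    D_v f at points near x. By continuity each lies within e/2 of the respective value at x. *)
Lemma derive_commute (f : V -> K^o) x u v :
  (\forall y \near x, derivable f y u) ->
  (\forall y \near x, derivable f y v) ->
  (\forall y \near x, derivable ('D_u f : V -> K^o) y v) ->
  (\forall y \near x, derivable ('D_v f : V -> K^o) y u) ->
  {for x, continuous ('D_v ('D_u f : V -> K^o) : V -> K^o)} ->
  {for x, continuous ('D_u ('D_v f : V -> K^o) : V -> K^o)} ->
  'D_v ('D_u f : V -> K^o) x = 'D_u ('D_v f : V -> K^o) x.
Proof.
move=> d1 d2 d3 d4 c1 c2.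
set a := LHS; set b := RHS.
apply/eqP; rewrite -subr_eq0 -normr_le0; apply/ler_addgt0Pl => e e0.
rewrite addr0.
have e20 : 0 < e / 2 by rewrite divr_gt0.
have n1 : \forall y \near x, `|a - 'D_v ('D_u f : V -> K^o) y| < e / 2.
  by move/cvgr_dist_lt : c1; apply.
have n2 : \forall y \near x, `|b - 'D_u ('D_v f : V -> K^o) y| < e / 2.
  by move/cvgr_dist_lt : c2; apply.
have : \forall y \near x, [/\ derivable f y u, derivable f y v,
    derivable ('D_u f : V -> K^o) y v, derivable ('D_v f : V -> K^o) y u &
    `|a - 'D_v ('D_u f : V -> K^o) y| < e / 2 /\
    `|b - 'D_u ('D_v f : V -> K^o) y| < e / 2].
  apply: filterS (filterI (filterI (filterI d1 d2) (filterI d3 d4)) (filterI n1 n2)).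
  by move=> y [[[? ?] [? ?]] [? ?]]; split.
move=> /nbhs_normP[r /= r0 Pr].
(* Points of the parallelogram are within h w of x, and h w = r / 2 < r; the summand 1 keeps w
   positive when u = v = 0. *)
pose w := `|u| + `|v| + 1.
have w0 : 0 < w by rewrite /w ltr_wpDl // addr_ge0.
pose h := r / w / 2.
have h0 : 0 < h by rewrite /h !divr_gt0.
have h2 : h ^+ 2 != 0 by rewrite expf_neq0 // gt_eqF.
have hw : h * w < r.
  by rewrite /h mulrAC divfK ?gt_eqF // ltr_pdivrMr // ltr_pMr // ltr1n.
have close s t : 0 <= s <= h -> 0 <= t <= h -> `|x - (x + s *: u + t *: v)| < r.
  move=> /andP[s0 sh] /andP[t0 th].
  rewrite -addrA opprD addNKr normrN; apply: le_lt_trans hw.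
  rewrite (le_trans (ler_normD _ _)) // !normrZ !ger0_norm //.
  rewrite /w !mulrDr mulr1 -[X in X <= _]addr0; apply: lerD (ltW h0).
  by apply: lerD; exact: ler_wpM2r.
have [s t sh th|s [t [sh th E1]]] := @mixed_difference_mvt f x u v h h0.
  have [du _ dvu _ _] := Pr _ (close _ _ sh th); exact: (conj du dvu).
have [a1 a2 sh1 sh2|s' [t' [sh' th' E2]]] := @mixed_difference_mvt f x v u h h0.
  rewrite addrAC; have [_ dv _ duv _] := Pr _ (close _ _ sh2 sh1).
  exact: (conj dv duv).
have [_ _ _ _ [A _]] := Pr _ (close _ _ sh th).
have [_ _ _ _ [_ B]] := Pr _ (close _ _ th' sh').
rewrite mixed_differenceC E1 in E2; move/(mulfI h2): E2 => E2.
rewrite [x + _ + _]addrAC -E2 in B.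
apply: le_trans (ler_distD ('D_v ('D_u f : V -> K^o) (x + s *: u + t *: v)) _ _) _.
rewrite distrC in B; rewrite (splitr e).
exact: lerD (ltW A) (ltW B).
Qed.
End Schwarz.

(** * Derivability of determinants and inverse matrices *)

Section DerivableDeterminant.
Variables (K : realType) (V : normedModType K).

Lemma derivable_big_sum (I : Type) (r : seq I) (F : I -> V -> K^o) x v :
  (forall i, derivable (F i) x v) ->
  derivable (fun y => \sum_(i <- r) F i y : K^o) x v.
Proof.
move=> dF; elim: r => [|i r IH].
  have -> : (fun y => \sum_(i <- [::]) F i y : K^o) = cst 0.
    by apply/funext => y; rewrite big_nil.
  exact: derivable_cst.
have -> : (fun y => \sum_(j <- i :: r) F j y : K^o) =
    F i + (fun y => \sum_(j <- r) F j y : K^o).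
  by apply/funext => y; rewrite big_cons.
exact: derivableD.
Qed.

Lemma derivable_big_prod (I : Type) (r : seq I) (F : I -> V -> K) x v :
  (forall i, derivable (F i : V -> K^o) x v) ->
  derivable (fun y => \prod_(i <- r) F i y : K^o) x v.
Proof.
move=> dF; elim: r => [|i r IH].
  have -> : (fun y => \prod_(i <- [::]) F i y : K^o) = cst 1.
    by apply/funext => y; rewrite big_nil.
  exact: derivable_cst.
have -> : (fun y => \prod_(j <- i :: r) F j y : K^o) =
    F i * (fun y => \prod_(j <- r) F j y : K^o).
  by apply/funext => y; rewrite big_cons.
exact: derivableM.
Qed.

Lemma derivable_det m (A : V -> 'M[K]_m) x v :
  (forall i j, derivable (fun y => A y i j : K^o) x v) ->
  derivable (fun y => \det (A y) : K^o) x v.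
Proof.
move=> dA; rewrite /determinant.
apply: derivable_big_sum => s.
apply: (derivableM (f := cst ((-1) ^+ perm.odd_perm s))
  (g := fun y => \prod_i A y i (perm.fun_of_perm s i))).
  exact: derivable_cst.
exact: derivable_big_prod.
Qed.

(** Near x the inverse is given by cofactors over the determinant. The invertibility must hold on a
    neighbourhood, since [invmx] returns a singular matrix unchanged. *)
Lemma derivable_invmx m (A : V -> 'M[K]_m) x v i j :
  (forall i j, derivable (fun y => A y i j : K^o) x v) ->
  (\forall y \near x, A y \in unitmx) ->
  derivable (fun y => invmx (A y) i j : K^o) x v.
Proof.
move=> dA uA.
have [v0|v0] := eqVneq v 0; first by rewrite v0; exact: derivable0.
apply: (@near_eq_derivable _ _ _
  ((fun y => (\det (A y))^-1) * (fun y => cofactor (A y) j i))) => //.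
  apply: filterS uA => y uAy.
  by rewrite /invmx uAy !mxE.
apply: derivableM.
  apply: derivableV; last exact: derivable_det.
  by rewrite -unitfE -unitmxE; exact: nbhs_singleton uA.
apply: (derivableM (f := cst ((-1) ^+ (j + i)%N))
  (g := fun y => \det (row' j (col' i (A y))))).
  exact: derivable_cst.
apply: derivable_det => a b.
have -> : (fun y => row' j (col' i (A y)) a b : K^o) =
    (fun y => A y (lift j a) (lift i b) : K^o).
  by apply/funext => y; rewrite !mxE.
exact: dA.
Qed.
End DerivableDeterminant.

Lemma smooth_on_partialC (K : realType) (n : nat) (U : set 'rV[K]_n)
    (f : 'rV[K]_n -> K^o) (i j : 'I_n) x :
  open U -> smooth_on U f -> U x ->
  partial i (partial j f) x = partial j (partial i f) x.
Proof.
move=> oU sf Ux.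
have nU : \forall y \near x, U y by exact: open_nbhs_nbhs.
apply: derive_commute.
- by apply: filterS nU => y Uy; apply: diff_derivable; exact: (sf [::] y Uy).
- by apply: filterS nU => y Uy; apply: diff_derivable; exact: (sf [::] y Uy).
- by apply: filterS nU => y Uy; apply: diff_derivable; exact: (sf [:: j] y Uy).
- by apply: filterS nU => y Uy; apply: diff_derivable; exact: (sf [:: i] y Uy).
- by apply: differentiable_continuous; exact: (sf [:: i; j] x Ux).
- by apply: differentiable_continuous; exact: (sf [:: j; i] x Ux).
Qed.

(** * Symmetries of the Riemann tensor *)

Section RiemannSymmetries.
Local Open Scope classical_set_scope.
Variables (K : realType) (n : nat) (U : set 'rV[K]_n) (G : 'rV[K]_n -> 'M[K]_n).
Hypothesis openU : open U.
Hypothesis smoothG : forall a b, smooth_on U (fun x => G x a b : K^o).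
Hypothesis symG : forall x, U x -> (G x)^T = G x.
Hypothesis unitG : forall x, U x -> G x \in unitmx.

Let GC x a b : U x -> G x a b = G x b a.
Proof. by move=> Ux; rewrite -[in LHS](symG Ux) mxE. Qed.

Let nearU x : U x -> \forall y \near x, U y.
Proof. by move=> Ux; exact: open_nbhs_nbhs. Qed.

(** The properties of G are assumed on U only; as U is open, they can still be used under a
    derivative at a point of U. *)
Lemma eq_partial (f h : 'rV[K]_n -> K^o) a x :
  U x -> (forall y, U y -> f y = h y) -> partial a f x = partial a h x.
Proof.
move=> Ux fh; rewrite /partial.
have [v0|v0] := eqVneq (delta_mx 0 a : 'rV[K]_n) 0; first by rewrite v0 !derive0.
by apply: near_eq_derive => //; apply: filterS (nearU Ux).
Qed.

Lemma dgramC a i j x : U x -> dgram G a i j x = dgram G a j i x.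
Proof. by move=> Ux; apply: eq_partial => // y Uy; exact: GC. Qed.

Lemma dgram_derivable a i j x v : U x -> derivable (dgram G a i j : _ -> K^o) x v.
Proof. by move=> Ux; apply: diff_derivable; exact: (smoothG i j [:: a] Ux). Qed.

Lemma gram_derivable i j x v : U x -> derivable (fun y => G y i j : K^o) x v.
Proof. by move=> Ux; apply: diff_derivable; exact: (smoothG i j [::] Ux). Qed.

Definition ddgram a b i j x : K := partial a (dgram G b i j : _ -> K^o) x.

Lemma ddgramC a b i j x : U x -> ddgram a b i j x = ddgram b a i j x.
Proof. by move=> Ux; exact: (smooth_on_partialC _ _ openU). Qed.

Lemma ddgram_sym a b i j x : U x -> ddgram a b i j x = ddgram a b j i x.
Proof. by move=> Ux; apply: eq_partial => // y; exact: dgramC. Qed.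

Lemma christoffelC k i j x : U x -> christoffel G k i j x = christoffel G k j i x.
Proof.
move=> Ux; rewrite /christoffel; congr (_ * _); apply: eq_bigr => l _.
by rewrite (dgramC l i j Ux); ring.
Qed.

(* Christoffel symbols of the first kind: g(nabla_(d_j) d_k, d_m). *)
Definition christoffel_low m j k x : K :=
  2^-1 * (dgram G j k m x + dgram G k j m x - dgram G m j k x).

Lemma christoffel_lowE m j k x : U x ->
  \sum_l christoffel G l j k x * G x l m = christoffel_low m j k x.
Proof.
move=> Ux; rewrite /christoffel /christoffel_low.
pose d p := dgram G j k p x + dgram G k j p x - dgram G p j k x.
transitivity (2^-1 * \sum_p (G x *m invmx (G x)) m p * d p).
  rewrite mulr_sumr.
  under [RHS]eq_bigr => p _ do rewrite mxE mulr_suml mulr_sumr.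
  rewrite exchange_big; apply: eq_bigr => l _.
  rewrite mulr_sumr mulr_suml; apply: eq_bigr => p _.
  by rewrite (GC m l Ux) /d; ring.
rewrite mulmxV ?unitG // (bigD1 m) //= mxE eqxx mul1r big1 ?addr0 // => p pm.
by rewrite mxE eq_sym (negPf pm) mul0r.
Qed.

Lemma christoffel_derivable k i j x v : U x ->
  derivable (christoffel G k i j : _ -> K^o) x v.
Proof.
move=> Ux.
apply: (derivableM (f := cst 2^-1) (g := fun y => \sum_l invmx (G y) k l *
  (dgram G i j l y + dgram G j i l y - dgram G l i j y))).
  exact: derivable_cst.
apply: derivable_big_sum => l.
apply: (derivableM (f := fun y => invmx (G y) k l)
  (g := fun y => dgram G i j l y + dgram G j i l y - dgram G l i j y)).
  apply: derivable_invmx => [a b|]; first exact: gram_derivable.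
  by apply: filterS (nearU Ux) => y; exact: unitG.
apply: (derivableB (f := (dgram G i j l : _ -> K^o) + dgram G j i l)
  (g := dgram G l i j)); last exact: dgram_derivable.
by apply: derivableD; exact: dgram_derivable.
Qed.

Lemma partial_christoffel_low i m j k x : U x ->
  partial i (christoffel_low m j k : _ -> K^o) x =
  2^-1 * (ddgram i j k m x + ddgram i k j m x - ddgram i m j k x).
Proof.
move=> Ux; rewrite /partial.
have dD a b c := @dgram_derivable a b c x (delta_mx 0 i) Ux.
rewrite (_ : christoffel_low m j k = 2^-1 \*:
  ((dgram G j k m : _ -> K^o) + dgram G k j m - dgram G m j k)) //.
rewrite deriveZ; last by apply: derivableB => //; apply: derivableD.
by rewrite deriveB //; [rewrite deriveD | apply: derivableD].
Qed.

(* Differentiating the lowered symbols avoids the derivative of the inverse metric. *)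
Lemma partial_christoffel_sum i m j k x : U x ->
  partial i (christoffel_low m j k : _ -> K^o) x =
  \sum_l (partial i (christoffel G l j k : _ -> K^o) x * G x l m +
    christoffel G l j k x * dgram G i l m x).
Proof.
move=> Ux.
rewrite -(@eq_partial (\sum_l ((christoffel G l j k : _ -> K) *
    (fun y => G y l m : K))) _ i x Ux) => [|y Uy]; last first.
  by rewrite fct_sumE -christoffel_lowE.
rewrite /partial derive_sum => [|l]; last first.
  by apply: derivableM; [exact: christoffel_derivable|exact: gram_derivable].
apply: eq_bigr => l _.
rewrite deriveM; [|exact: christoffel_derivable|exact: gram_derivable].
by rewrite addrC; congr (_ + _); rewrite [LHS]mulrC.
Qed.

Definition curvature_low i j k m x : K := \sum_l curvature13 G i j k l x * G x l m.

(* g(nabla_(d_i) d_j, nabla_(d_k) d_m) *)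
Definition christoffel_form i j k m x : K :=
  \sum_l christoffel G l i j x * christoffel_low l k m x.

Lemma christoffel_formC i j k m x : U x ->
  christoffel_form i j k m x = christoffel_form k m i j x.
Proof.
move=> Ux; rewrite /christoffel_form.
under eq_bigr => l _ do rewrite -christoffel_lowE // mulr_sumr.
rewrite exchange_big; apply: eq_bigr => p _.
rewrite -christoffel_lowE // mulr_sumr; apply: eq_bigr => l _.
by rewrite (GC l p Ux); ring.
Qed.

Lemma christoffel_formCl i j k m x : U x ->
  christoffel_form i j k m x = christoffel_form j i k m x.
Proof. by move=> Ux; apply: eq_bigr => l _; rewrite (christoffelC _ i). Qed.

(* [ring] compares atoms up to conversion, which diverges on derivatives; naming
   the atoms first avoids this. *)
Ltac ring_generalizing :=
  repeat match goal with
  | |- context [ddgram ?a ?b ?i ?j ?x] => generalize (ddgram a b i j x) => ?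
  | |- context [christoffel_form ?i ?j ?k ?m ?x] =>
      generalize (christoffel_form i j k m x) => ?
  | |- context [christoffel G ?i ?j ?k ?x] => generalize (christoffel G i j k x) => ?
  | |- context [christoffel_low ?i ?j ?k ?x] =>
      generalize (christoffel_low i j k x) => ?
  | |- context [partial ?i ?f ?x] => generalize (partial i f x) => ?
  end; ring.

(** Lowering d_i Gamma^l_jk gives d_i of the lowered symbol minus Gamma^l_jk d_i g_lm. Metric
    compatibility splits d_i g_lm into two lowered symbols: one cancels the quadratic part of
    [curvature13], the other gives the scalar products. *)
Lemma curvature_lowE i j k m x : U x -> curvature_low i j k m x =
  2^-1 * (ddgram i k j m x - ddgram i m j k x - ddgram j k i m x + ddgram j m i k x)
  - (christoffel_form j k i m x - christoffel_form i k j m x).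
Proof.
move=> Ux.
(* Compatibility of the connection with the metric. *)
have lowD a p : dgram G a p m x = christoffel_low m a p x + christoffel_low p a m x.
  by rewrite /christoffel_low (dgramC a m p Ux); field.
transitivity (partial i (christoffel_low m j k : _ -> K^o) x
  - partial j (christoffel_low m i k : _ -> K^o) x
  - (christoffel_form j k i m x - christoffel_form i k j m x)); last first.
  rewrite !(partial_christoffel_low _ _ _ _ Ux).
  (* The terms d_i d_j g_km and d_j d_i g_km cancel. *)
  rewrite (ddgramC i j k m Ux); ring_generalizing.
rewrite !partial_christoffel_sum // /christoffel_form -!sumrB.
pose quad l := \sum_p (christoffel G p j k x * christoffel G l i p x -
  christoffel G p i k x * christoffel G l j p x).
transitivity (\sum_l ((partial i (christoffel G l j k : _ -> K^o) x
  - partial j (christoffel G l i k : _ -> K^o) x) * G x l m)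
  + \sum_l quad l * G x l m).
  by rewrite -big_split; apply: eq_bigr => l _; rewrite /= -mulrDl.
have -> : \sum_l quad l * G x l m = \sum_p
    (christoffel G p j k x * christoffel_low m i p x -
     christoffel G p i k x * christoffel_low m j p x).
  under eq_bigr => l _ do rewrite mulr_suml.
  rewrite exchange_big; apply: eq_bigr => p _.
  rewrite -!(christoffel_lowE _ _ _ Ux) !mulr_sumr -sumrB.
  by apply: eq_bigr => l _; ring_generalizing.
rewrite -big_split; apply: eq_bigr => p _ /=.
rewrite (lowD i p) (lowD j p).
have alg (a b c d e r s t u : K) : (a - b) * c + (d * e - r * s) =
  a * c + d * (e + t) - (b * c + r * (s + u)) - (d * t - r * u) by ring.
exact: alg.
Qed.

Lemma curvature_low12 i j k m x : U x ->
  curvature_low i j k m x = - curvature_low j i k m x.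
Proof. by move=> Ux; rewrite !(curvature_lowE _ _ _ _ Ux); ring_generalizing. Qed.

Lemma curvature_low34 i j k m x : U x ->
  curvature_low i j k m x = - curvature_low i j m k x.
Proof.
move=> Ux; rewrite !(curvature_lowE _ _ _ _ Ux).
rewrite (christoffel_formC j k _ _ Ux) (christoffel_formC i k _ _ Ux).
by ring_generalizing.
Qed.

(** The exchange of (i, j) and (k, m) permutes the second-order terms, by equality of mixed partials
    and symmetry of g, and preserves the quadratic ones, by symmetry of g and of the Christoffel
    symbols in their lower indices. *)
Lemma curvature_low_pair i j k m x : U x ->
  curvature_low i j k m x = curvature_low k m i j x.
Proof.
move=> Ux; rewrite !(curvature_lowE _ _ _ _ Ux).
rewrite (ddgramC k i _ _ Ux) (ddgramC k j _ _ Ux) (ddgramC m i _ _ Ux)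
  (ddgramC m j _ _ Ux) (ddgram_sym i k m j Ux) (ddgram_sym j k m i Ux)
  (ddgram_sym i m k j Ux) (ddgram_sym j m k i Ux).
rewrite (christoffel_formCl m i k j Ux) (christoffel_formC i m k j Ux)
  (christoffel_formCl k j i m Ux) (christoffel_formCl k i m j Ux)
  (christoffel_formC i k j m Ux) (christoffel_formCl j m i k Ux)
  (christoffel_formC m j i k Ux).
ring_generalizing.
Qed.

Local Notation Rm := (riemann G).

Lemma riemannE x X1 X2 X3 X4 : Rm x X1 X2 X3 X4 =
  \sum_i \sum_j \sum_k \sum_m
    X1 0 i * X2 0 j * X3 0 k * X4 0 m * curvature_low i j k m x.
Proof.
apply: eq_bigr => i _; apply: eq_bigr => j _; apply: eq_bigr => k _.
by rewrite exchange_big; apply: eq_bigr => m _; rewrite -mulr_sumr.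
Qed.

Lemma riemann1 x X2 X3 X4 : scalar (fun X => Rm x X X2 X3 X4).
Proof. by do 5!apply: scalar_sum => ?; move=> k u v; rewrite !mxE; ring. Qed.

Lemma riemann2 x X1 X3 X4 : scalar (fun X => Rm x X1 X X3 X4).
Proof. by do 5!apply: scalar_sum => ?; move=> k u v; rewrite !mxE; ring. Qed.

Lemma riemann3 x X1 X2 X4 : scalar (fun X => Rm x X1 X2 X X4).
Proof. by do 5!apply: scalar_sum => ?; move=> k u v; rewrite !mxE; ring. Qed.

Lemma riemann4 x X1 X2 X3 : scalar (Rm x X1 X2 X3).
Proof. by do 5!apply: scalar_sum => ?; move=> k u v; rewrite !mxE; ring. Qed.

Lemma riemann12 x X1 X2 X3 X4 : U x -> Rm x X1 X2 X3 X4 = - Rm x X2 X1 X3 X4.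
Proof.
move=> Ux; rewrite !riemannE exchange_big -sumrN; apply: eq_bigr => j _.
rewrite -sumrN; apply: eq_bigr => i _; rewrite -sumrN; apply: eq_bigr => k _.
rewrite -sumrN; apply: eq_bigr => m _.
by rewrite (curvature_low12 _ _ _ _ Ux); ring.
Qed.

Lemma riemann34 x X1 X2 X3 X4 : U x -> Rm x X1 X2 X3 X4 = - Rm x X1 X2 X4 X3.
Proof.
move=> Ux; rewrite !riemannE -sumrN; apply: eq_bigr => i _.
rewrite -sumrN; apply: eq_bigr => j _; rewrite exchange_big -sumrN.
apply: eq_bigr => m _; rewrite -sumrN; apply: eq_bigr => k _.
by rewrite (curvature_low34 _ _ _ _ Ux); ring.
Qed.

Lemma riemann_pair x X1 X2 X3 X4 : U x -> Rm x X1 X2 X3 X4 = Rm x X3 X4 X1 X2.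
Proof.
move=> Ux; rewrite !riemannE.
under [RHS]eq_bigr => k _ do rewrite exchange_big.
rewrite [RHS]exchange_big; apply: eq_bigr => i _ /=.
under [RHS]eq_bigr => k _ do rewrite exchange_big.
rewrite [RHS]exchange_big; apply: eq_bigr => j _ /=.
apply: eq_bigr => k _; apply: eq_bigr => m _.
by rewrite (curvature_low_pair _ _ _ _ Ux); ring.
Qed.
End RiemannSymmetries.

(** * From the pointwise algebra to the manifold *)

Theorem theorem4p2 (K : realType) (n : nat) (hn : (3 <= n)%N)
    (M : semi_riemannian K n) :
  (everywhere M (fun G Rm => forall X1 X2 X3 X4 X Y : 'rV[K]_n,
      wedge_R_ricci G Rm X1 X2 X3 X4 X Y =
      (n%:R - 1)^-1 *
        dot4 G (wedge_ricci G Rm) (wedge_ricci G Rm) X1 X2 X3 X4 X Y) ->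
    cyclic_PP M)
  /\
  (cyclic_PP M ->
    [/\ everywhere M (fun G Rm => forall X1 X2 X Y : 'rV[K]_n,
          n%:R * (n%:R - 1) * dot2 G Rm (ricci G Rm) X1 X2 X Y =
          scalar_curvature G Rm * Q2 (ip G) (ricci G Rm) X1 X2 X Y),
        everywhere M (fun G Rm => forall X1 X2 X3 X4 : 'rV[K]_n,
          kulkarni_nomizu (ricci G Rm) (ricci G Rm) X1 X2 X3 X4 =
          kulkarni_nomizu (ip G) (ricci_sq G Rm) X1 X2 X3 X4),
        everywhere M (fun G Rm => forall X Y : 'rV[K]_n,
          n%:R ^+ 2 * ricci_sq G Rm X Y
          - 2 * n%:R * scalar_curvature G Rm * ricci G Rm X Y
          + scalar_curvature G Rm ^+ 2 * ip G X Y = 0)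
      & riemannian M -> einstein M]).
Proof.
have chartU (c : chart M) p : dom c p ->
    (Defs.coord c @` dom c)%classic (Defs.coord c p).
  by move=> cp; exists p.
have openU (c : chart M) := @coord_open _ _ M c.
have smoothG (c : chart M) := @gram_smooth _ _ M c.
have symG (c : chart M) x : (Defs.coord c @` dom c)%classic x ->
    (gram c x)^T = gram c x.
  by case=> p cp <-; exact: gram_sym.
have unitG (c : chart M) x : (Defs.coord c @` dom c)%classic x ->
    gram c x \in unitmx.
  by case=> p cp <-; exact: gram_nondegenerate.
(* At each point of each chart the Riemann tensor has the symmetries of an algebraic curvature
   tensor, so the pointwise results apply to it and the Gram matrix there. *)
have R12 (c : chart M) p (cp : dom c p) X1 X2 X3 X4 :=
  riemann12 (openU c) (smoothG c) (symG c) (unitG c) X1 X2 X3 X4 (chartU c p cp).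
have R34 (c : chart M) p (cp : dom c p) X1 X2 X3 X4 :=
  riemann34 (openU c) (smoothG c) (symG c) (unitG c) X1 X2 X3 X4 (chartU c p cp).
have Rpair (c : chart M) p (cp : dom c p) X1 X2 X3 X4 :=
  riemann_pair (openU c) (smoothG c) (symG c) (unitG c) X1 X2 X3 X4 (chartU c p cp).
split=> [W p c cp|PP].
  apply: (cyclic_of_wedge (gram_nondegenerate cp) (gram_sym cp) (@riemann1 _ _ _ _)
    (@riemann2 _ _ _ _) (@riemann3 _ _ _ _) (@riemann4 _ _ _ _)
    (R12 c p cp) (R34 c p cp) (Rpair c p cp)) => X1 X2 X3 X4 X Y.
  exact: W.
have ric (c : chart M) p (cp : dom c p) X Y := ricci_of_cyclic
  (gram_nondegenerate cp) (gram_sym cp) (@riemann1 _ _ _ _)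
  (@riemann2 _ _ _ _) (@riemann3 _ _ _ _) (@riemann4 _ _ _ _)
  (R12 c p cp) (R34 c p cp) (Rpair c p cp) hn (PP p c cp) X Y.
have concl (c : chart M) p (cp : dom c p) := einstein_conclusions
  (gram_nondegenerate cp) (gram_sym cp) (@riemann3 _ _ _ _)
  (@riemann4 _ _ _ _) (R12 c p cp) (R34 c p cp) (Rpair c p cp) hn (ric c p cp).
split=> [p c cp|p c cp|p c cp|_ p c cp].
- by have [] := concl c p cp.
- by have [] := concl c p cp.
- by have [] := concl c p cp.
- exact: ric.
Qed.
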